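(* Let $X$ be a real Banach space and let $F\subseteq X^*$ be a norming subspace. The following statements are equivalent: (i) $X$ admits an equivalent norm which is $\sigma(X,F)$-lower semicontinuous and $\sigma(X,F)$-LUR; (ii) $X$ admits an equivalent $\sigma(X,F)$-lower semicontinuous norm such that, denoting by $S_X$ its unit sphere, $(S_X,\sigma(X,F))$ is symmetrized by a symmetric $\rho$ with the property that for every $x\in S_X$ and every $\varepsilon>0$ there is a $\sigma(X,F)$-open slice of $S_X$ containing $x$ and having $\rho$-diameter less than $\varepsilon$; (iii) $X$ admits an equivalent $\sigma(X,F)$-lower semicontinuous norm such that, denoting by $S_X$ its unit sphere, there is a development $(\mathcal{F}_n)_{n\in\mathbb{N}}$ of $(S_X,\sigma(X,F))$ such that every element of every $\mathcal{F}_n$ is a $\sigma(X,F)$-open slice of $S_X$.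
   Context: $\sigma(X,F)$ is the topology on $X$ of pointwise convergence on $F$. A subset $B\subseteq B_{X^*}$ is norming if $\|x\|_B=\sup_{b^*\in B}|b^*(x)|$ is a norm on $X$ equivalent to the original one; a subspace $F\subseteq X^*$ is norming if $F\cap B_{X^*}$ is norming. For a topology $\tau$ on $X$, a norm $\|\cdot\|$ is $\tau$-LUR if for all $x\in X$ and $(x_n)_{n\in\mathbb{N}}\subseteq X$ with $\lim_n(2\|x\|^2+2\|x_n\|^2-\|x+x_n\|^2)=0$ one has $x_n\to x$ in $\tau$. A $\sigma(X,F)$-open slice of a set $A\subseteq X$ is the intersection of $A$ with a $\sigma(X,F)$-open half-space $\{x\in X: f(x)>\alpha\}$, where $f\in F$, $f\neq 0$, $\alpha\in\mathbb{R}$. A symmetric on a nonempty set $T$ is a function $\rho:T\times T\to[0,+\infty)$ with $\rho(x,y)=\rho(y,x)$ for all $x,y\in T$, and $\rho(x,y)=0$ if and only if $x=y$ (no triangle inequality is assumed). Put $B_\rho(x,\varepsilon)=\{y\in T:\rho(x,y)<\varepsilon\}$; the $\rho$-diameter of $D\subseteq T$ is $\sup\{\rho(x,y):x,y\in D\}$. A topological space $T$ is symmetrized by $\rho$ if a set $U\subseteq T$ is open if and only if for every $x\in U$ there is $\varepsilon>0$ with $B_\rho(x,\varepsilon)\subseteq U$. A development of a topological space $T$ is a sequence $(\mathcal{G}_n)_{n\in\mathbb{N}}$ of open coverings of $T$ such that for every $x\in T$ the sets $\mathrm{St}(x,\mathcal{G}_n)=\bigcup\{U\in\mathcal{G}_n:x\in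 U\}$, $n\in\mathbb{N}$, form a neighbourhood base at $x$. *)

(* Defs.v *)
From HB Require Import structures.
From mathcomp Require Import all_boot all_order all_algebra.
From mathcomp Require Import all_classical all_reals all_analysis.

Set Implicit Arguments.
Unset Strict Implicit.
Unset Printing Implicit Defensive.

Import Order.TTheory GRing.Theory Num.Theory.
Import numFieldNormedType.Exports.

Local Open Scope classical_set_scope.
Local Open Scope ring_scope.

Section Norms.
Context {R : realType} {X : normedModType R}.

Definition is_norm (N : X -> R) :=
  [/\ forall x y, N (x + y) <= N x + N y,
      forall (a : R) x, N (a *: x) = `|a| * N x
    & forall x, N x = 0 -> x = 0].

Definition equivalent_norm (N : X -> R) :=
  is_norm N /\
  exists c C : R, [/\ 0 < c, 0 < C & forall x, c * `|x| <= N x <= C * `|x|].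

Definition unit_sphere (N : X -> R) : set X := [set x | N x = 1].

End Norms.

Section Dual.
Context {R : realType} {X : normedModType R}.

Definition dual_space : set (X -> R^o) :=
  [set f | linear f /\ continuous f].

Definition dual_norm (f : X -> R^o) : R :=
  sup [set `|f x| | x in [set x : X | `|x| <= 1]].

Definition dual_ball : set (X -> R^o) :=
  [set f | dual_space f /\ dual_norm f <= 1].

Definition dual_subspace (F : set (X -> R^o)) :=
  [/\ F `<=` dual_space,
      F 0,
      forall f g, F f -> F g -> F (f + g)
    & forall (a : R) f, F f -> F (a *: f)].

Definition norming_set (B : set (X -> R^o)) :=
  B `<=` dual_ball /\
  equivalent_norm (fun x : X => sup [set `|b x| | b in B]).

Definition norming_subspace (F : set (X -> R^o)) :=
  dual_subspace F /\ norming_set (F `&` dual_ball).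

End Dual.

Section PointwiseTopology.
Context {R : realType} {X : normedModType R} (F : set (X -> R^o)).

(* sigma(X,F): a copy of X carrying the initial topology of the evaluation map
   x |-> (f |-> f x) into R^F with the topology of pointwise convergence. *)
Definition sigma_eval (x : X) : {ptws F -> R^o} := fun f : F => set_val f x.

Definition sigma_space : topologicalType := initial_topology sigma_eval.

Definition sigma_lsc (N : X -> R) :=
  lower_semicontinuous (fun x : sigma_space => (N x)%:E).

Definition sigma_LUR (N : X -> R) :=
  forall (x : X) (x_ : nat -> X),
    (fun n => 2 * N x ^+ 2 + 2 * N (x_ n) ^+ 2 - N (x + x_ n) ^+ 2) @ \oo
      --> (0 : R) ->
    (x_ : nat -> sigma_space) @ \oo --> (x : sigma_space).

(* The cast matters: without it the subtype would carry the norm topology. *)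
Definition sigma_sphere (N : X -> R) : topologicalType :=
  set_type (unit_sphere N : set sigma_space).

Definition sphere_slice (N : X -> R) (D : set (sigma_sphere N)) :=
  exists (f : X -> R^o) (alpha : R),
    [/\ F f, f <> 0 & D = [set x | f (set_val x) > alpha]].

End PointwiseTopology.

Section Symmetrics.
Context {R : realType}.

(* T may be empty, so that the sphere of the zero space is not excluded. *)
Definition symmetric_fun (T : Type) (rho : T -> T -> R) :=
  [/\ forall x y, 0 <= rho x y,
      forall x y, rho x y = rho y x
    & forall x y, rho x y = 0 <-> x = y].

Definition rho_ball (T : Type) (rho : T -> T -> R) (x : T) (e : R) : set T :=
  [set y | rho x y < e].

(* An extended real, since rho may be unbounded on D. *)
Definition rho_diameter (T : Type) (rho : T -> T -> R) (D : set T) : \bar R :=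
  ereal_sup [set (rho x y)%:E | x in D & y in D].

Definition symmetrized_by (T : topologicalType) (rho : T -> T -> R) :=
  forall U : set T, open U <->
    forall x, U x -> exists2 e : R, 0 < e & rho_ball rho x e `<=` U.

End Symmetrics.

Section Developments.
Context {T : topologicalType}.

Definition star (x : T) (G : set (set T)) : set T :=
  \bigcup_(U in [set U | G U /\ U x]) U.

Definition open_covering (G : set (set T)) :=
  G `<=` open /\ \bigcup_(U in G) U = [set: T].

Definition neighbourhood_base (x : T) (V : nat -> set T) :=
  (forall n, nbhs x (V n)) /\
  (forall W, nbhs x W -> exists n, V n `<=` W).

Definition development (G : nat -> set (set T)) :=
  (forall n, open_covering (G n)) /\
  (forall x, neighbourhood_base x (fun n => star x (G n))).

End Developments.

(* Main.v *)
(* (i) => (ii): take rho x y = 2 - N (x + y).  LUR makes every sequence with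
   rho x (x_n) -> 0 converge to x, lower semicontinuity makes rho-balls
   neighbourhoods, and a functional f in F with f <= N and f x > 1 - d cuts out a
   slice of rho-diameter at most 4 d.  Such f come from a finite-dimensional
   Hahn-Banach argument applied to the inf-convolution of N with a multiple of
   sum_i |f_i|, where the f_i define a basic sigma(X,F)-neighbourhood.

   (ii) => (iii): the n-th covering consists of the slices of rho-diameter less
   than 1 / (n + 1).

   (iii) => (i): normalise the slices {f > a} of the n-th covering so that
   f <= N, and let q_n be the supremum of the sublinear functionals
   max (f + (1 - a) N) N.  On the sphere of N each of them exceeds N exactly on
   its slice.  The new norm is M^2 = sum_k 2^-(k+1) (p_k(x)^2 + p_k(-x)^2), with
   p_0 = N and p_(n+1) = q_n.  If the LUR condition holds for M along x_k, then
   q_n(x_k) -> q_n(x) > N(x) and q_n(x + x_k) -> 2 q_n(x); a functional almost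
   attaining q_n(x + x_k) then almost attains q_n at both x and x_k, so that
   x / N(x) and x_k / N(x_k) lie in a common slice of the n-th covering. *)
Require Import Defs.
From HB Require Import structures.
From mathcomp Require Import all_boot all_order all_algebra.
From mathcomp Require Import all_classical all_reals all_analysis.
From mathcomp Require Import ring lra.

Set Implicit Arguments.
Unset Strict Implicit.
Unset Printing Implicit Defensive.

Import Order.TTheory GRing.Theory Num.Theory.
Import numFieldNormedType.Exports.

Local Open Scope classical_set_scope.
Local Open Scope ring_scope.

(** * Sublinear functionals and a finite-dimensional Hahn-Banach theorem *)

Section Sublinear.
Context {R : realType} {V : lmodType R}.
Implicit Types (p q : V -> R) (f g : V -> R^o).

Definition sublinear p :=
  (forall x y, p (x + y) <= p x + p y) /\
  (forall (a : R) x, 0 <= a -> p (a *: x) = a * p x).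

Lemma linear_fun0 f : linear f -> f 0 = 0 :> R.
Proof.
by move=> lf; have := lf (-1) 0 0; rewrite scaleN1r addNr scaleN1r addNr.
Qed.

Lemma linear_funD f : linear f -> forall x y, f (x + y) = f x + f y :> R.
Proof. by move=> lf x y; rewrite -[x in LHS]scale1r lf scale1r. Qed.

Lemma linear_funZ f : linear f -> forall (a : R) x, f (a *: x) = a * f x :> R.
Proof.
by move=> lf a x; rewrite -[a *: x]addr0 lf linear_fun0// addr0.
Qed.

Lemma linear_funN f : linear f -> forall x, f (- x) = - f x :> R.
Proof. by move=> lf x; rewrite -scaleN1r linear_funZ// mulN1r. Qed.

Lemma linear_funB f : linear f -> forall x y, f (x - y) = f x - f y :> R.
Proof. by move=> lf x y; rewrite linear_funD// linear_funN. Qed.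

Lemma sublinear0 p : sublinear p -> p 0 = 0.
Proof. by move=> [_ pZ]; rewrite -(scale0r 0) pZ// mul0r. Qed.

Lemma sublinear_ge p x : sublinear p -> - p (- x) <= p x.
Proof. by move=> ps; have := ps.1 x (- x); rewrite subrr sublinear0//; lra. Qed.

(** One inequality for positive scalars suffices: applying it with [a^-1] to [a *: x] gives the
    reverse one. *)
Lemma sublinearI p : (forall x y, p (x + y) <= p x + p y) -> p 0 = 0 ->
  (forall (a : R) x, 0 < a -> p (a *: x) <= a * p x) -> sublinear p.
Proof.
move=> pD p0 pZ; split=> // a x; rewrite le_eqVlt => /predU1P[<-|a0].
  by rewrite scale0r mul0r.
apply/le_anti; rewrite pZ//= -ler_pdivlMl//.
rewrite -[in leLHS](scalerK (lt0r_neq0 a0) x) pZ// invr_gt0//.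
Qed.

Lemma inf_le_add (A B C : set R) : has_lbound C -> A !=set0 -> B !=set0 ->
  (forall a b, A a -> B b -> exists2 c, C c & c <= a + b) ->
  inf C <= inf A + inf B.
Proof.
move=> Cl A0 B0 AB; rewrite -lerBlDr; apply: lb_le_inf => // a Aa.
rewrite lerBlDl -lerBlDr; apply: lb_le_inf => // b Bb.
have [c Cc cab] := AB a b Aa Bb.
by rewrite lerBlDl; apply: le_trans cab; exact: ge_inf.
Qed.

Lemma inf_le_mul (A C : set R) (k : R) : 0 < k -> has_lbound C -> A !=set0 ->
  (forall a, A a -> C (k * a)) -> inf C <= k * inf A.
Proof.
move=> k0 Cl A0 AC; rewrite -ler_pdivrMl//; apply: lb_le_inf => // a Aa.
by rewrite ler_pdivrMl//; apply: ge_inf => //; exact: AC.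
Qed.

(** Infimal convolution; for nonnegative sublinear [p] and [q] it is the largest sublinear
    functional below both. *)
Definition inf_conv p q x : R := inf [set p y + q (x - y) | y in [set: V]].

Section InfConv.
Variables (p q : V -> R) (ps : sublinear p) (qs : sublinear q).
Hypotheses (p0 : forall x, 0 <= p x) (q0 : forall x, 0 <= q x).

Let lb x : has_lbound [set p y + q (x - y) | y in [set: V]].
Proof. by exists 0 => _ [y _ <-]; exact: addr_ge0. Qed.

Let ne x : [set p y + q (x - y) | y in [set: V]] !=set0.
Proof. by eexists; exists 0. Qed.

Lemma inf_conv_lel x : inf_conv p q x <= p x.
Proof.
by apply: ge_inf => //; exists x => //; rewrite subrr sublinear0// addr0.
Qed.

Lemma inf_conv_ler x : inf_conv p q x <= q x.
Proof.
by apply: ge_inf => //; exists 0 => //; rewrite subr0 sublinear0// add0r.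
Qed.

Lemma inf_conv_ge x d : (forall y, d <= p y + q (x - y)) -> d <= inf_conv p q x.
Proof. by move=> H; apply: lb_le_inf => // _ [y _ <-]. Qed.

Lemma inf_conv_sublinear : sublinear (inf_conv p q).
Proof.
apply: sublinearI.
- move=> x y; apply: inf_le_add => // _ _ [u _ <-] [v _ <-].
  eexists; first by exists (u + v).
  have := ps.1 u v; have := qs.1 (x - u) (y - v).
  by rewrite addrACA -opprD; lra.
- apply/le_anti; rewrite inf_conv_ge ?andbT; last by move=> y; exact: addr_ge0.
  by apply: le_trans (inf_conv_lel 0) _; rewrite sublinear0.
- move=> a x a0; apply: inf_le_mul => // _ [y _ <-]; exists (a *: y) => //.
  by rewrite -scalerBr ps.2 ?(ltW a0)// qs.2 ?(ltW a0)// mulrDr.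
Qed.

End InfConv.

(* The largest sublinear [p <= q] with [p (- e) <= - q e]; such a [p] is linear along
   [e]. *)
Definition linearize q e x : R :=
  inf [set q (x + t *: e) - t * q e | t in [set t : R | 0 <= t]].

Section Linearize.
Variables (q : V -> R) (e : V) (qs : sublinear q).

Let lb x : has_lbound [set q (x + t *: e) - t * q e | t in [set t : R | 0 <= t]].
Proof.
exists (- q (- x)) => _ [t t0 <-]; have := qs.1 (x + t *: e) (- x).
by rewrite addrC addKr qs.2//; lra.
Qed.

Let ne x : [set q (x + t *: e) - t * q e | t in [set t : R | 0 <= t]] !=set0.
Proof. by eexists; exists 0 => /=. Qed.

Lemma linearize_le x : linearize q e x <= q x.
Proof.
by apply: ge_inf => //; exists 0 => /=; rewrite ?scale0r ?mul0r ?addr0 ?subr0.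
Qed.

Lemma linearize_opp : linearize q e (- e) <= - q e.
Proof.
apply: ge_inf => //; exists 1 => /=; rewrite ?ler01//.
by rewrite scale1r addNr sublinear0// mul1r add0r.
Qed.

Lemma linearize_sublinear : sublinear (linearize q e).
Proof.
apply: sublinearI.
- move=> x y; apply: inf_le_add => // _ _ [s /= s0 <-] [t /= t0 <-].
  eexists; first by exists (s + t) => //=; exact: addr_ge0.
  have := qs.1 (x + s *: e) (y + t *: e).
  by rewrite addrACA -scalerDl; lra.
- apply/le_anti/andP; split.
    by apply: le_trans (linearize_le 0) _; rewrite sublinear0.
  apply: lb_le_inf => // _ [t /= t0 <-].
  by rewrite add0r qs.2// subrr.
- move=> a x a0; apply: inf_le_mul => // _ [t /= t0 <-].
  exists (a * t); first by rewrite /= mulr_ge0// ltW.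
  by rewrite -scalerA -scalerDr qs.2 ?(ltW a0)// mulrBr mulrA.
Qed.

(** [linearize_opp] and sublinearity force opposite values at [e] and [- e], hence homogeneity for
    all real scalars on that line. Subadditivity, used to add [t *: e] and to remove it again, then
    gives both inequalities. *)
Lemma linearizeE x (t : R) :
  linearize q e (x + t *: e) = linearize q e x + t * linearize q e e.
Proof.
have [ls lZ] := linearize_sublinear.
have le := linearize_le e; have lo := linearize_opp.
have lN : linearize q e (- e) = - linearize q e e.
  by apply/le_anti/andP; split; have := sublinear_ge e linearize_sublinear; lra.
have lt s : linearize q e (s *: e) = s * linearize q e e.
  have [s0|/ltW s0] := leP 0 s; first exact: lZ.
  by rewrite -[s]opprK scaleNr -scalerN lZ ?oppr_ge0// lN; ring.
apply/le_anti/andP; split; first by rewrite -lt ls.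
have := ls (x + t *: e) (- t *: e).
by rewrite lt scaleNr addrK; lra.
Qed.

End Linearize.

(** * Dominated functionals in the span of finitely many functionals *)

Definition functional_subspace (G : set (V -> R^o)) :=
  [/\ G 0, forall f g, G f -> G g -> G (f + g)
    & forall (a : R) f, G f -> G (a *: f)].

Lemma mem_span_of_ker (G : set (V -> R^o)) (fs : seq (V -> R^o)) f :
  functional_subspace G -> (forall h, h \in fs -> linear h) ->
  (forall h, h \in fs -> G h) -> linear f ->
  (forall x, (forall h, h \in fs -> h x = 0) -> f x = 0) -> G f.
Proof.
move=> [G0 GD GZ]; elim: fs f => [|g fs IH] f lfs Gfs lf fker.
  by rewrite (_ : f = 0)//; apply/funext => x; exact: fker.
have lg : linear g by apply: lfs; rewrite mem_head.
have Gg : G g by apply: Gfs; rewrite mem_head.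
have lfs' h : h \in fs -> linear h by move=> hfs; apply: lfs; rewrite inE hfs orbT.
have Gfs' h : h \in fs -> G h by move=> hfs; apply: Gfs; rewrite inE hfs orbT.
have [[e [eker ge]]|noe] :=
    pselect (exists e, (forall h, h \in fs -> h e = 0) /\ g e <> 0).
  rewrite -(subrK ((f e / g e) *: g) f); apply: (GD); last exact: GZ.
  have ge' : g e != 0 by apply/eqP.
  apply: IH => //.
    move=> a x y /=; rewrite !fctE lf lg /GRing.scale/=; ring.
  move=> x xker; rewrite !fctE /=.
  have := fker (x - (g x / g e) *: e).
  rewrite linear_funB// linear_funZ// /GRing.scale/= => H.
  have -> : f e / g e * g x = g x / g e * f e by field.
  apply: H => h; rewrite inE => /predU1P[->|hfs].
    by rewrite linear_funB// linear_funZ// divfK// subrr.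
  have lh := lfs' _ hfs.
  by rewrite linear_funB// linear_funZ// (xker h)// (eker h)// mulr0 subrr.
apply: IH => // x xker; apply: fker => h; rewrite inE => /predU1P[->|]; last exact: xker.
by apply: contrapT => gx; apply: noe; exists x.
Qed.

(** The functionals dominated by a multiple of the sum form a subspace containing [fs], to which
    [mem_span_of_ker] applies. *)
Lemma le_span_of_ker (fs : seq (V -> R^o)) g :
  (forall h, h \in fs -> linear h) -> linear g ->
  (forall x, (forall h, h \in fs -> h x = 0) -> g x = 0) ->
  exists2 C : R, 0 <= C & forall x, `|g x| <= C * \sum_(h <- fs) `|h x|.
Proof.
move=> lfs lg gker.
pose G : set (V -> R^o) :=
  [set h | exists2 C : R, 0 <= C & forall x, `|h x| <= C * \sum_(h <- fs) `|h x|].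
apply: (@mem_span_of_ker G fs g) => //.
  split.
  - by exists 0 => // x; rewrite normr0 mul0r.
  - move=> f h [C C0 fC] [D D0 hD]; exists (C + D); first exact: addr_ge0.
    move=> x; rewrite mulrDl; apply: le_trans (ler_normD _ _) _.
    exact: lerD.
  - move=> a h [C C0 hC]; exists (`|a| * C); first exact: mulr_ge0.
    by move=> x; rewrite !fctE normrM -mulrA ler_wpM2l.
move=> h hfs; exists 1 => // x; rewrite mul1r (big_rem h)//=.
by rewrite lerDl; apply: sumr_ge0.
Qed.

(** The bound by finitely many seminorms [|h x|] is what places [f] in [G]. Induction on [fs]:
    linearizing [q] along a vector [e] seen by [g] but not by the tail, then subtracting a multiple
    of [g], leaves a functional controlled by the tail. *)
Lemma finite_hahn_banach (G : set (V -> R^o)) (fs : seq (V -> R^o)) q (M : R) :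
  functional_subspace G -> (forall h, h \in fs -> linear h) ->
  (forall h, h \in fs -> G h) -> sublinear q -> 0 <= M ->
  (forall x, q x <= M * \sum_(h <- fs) `|h x|) ->
  exists f, [/\ G f, linear f & forall x, f x <= q x].
Proof.
move=> Gs; have [G0 GD GZ] := Gs.
elim: fs q M => [|g fs IH] q M lfs Gfs qs M0 qM.
  have zeroE x : (0 : V -> R^o) x = 0 by [].
  exists 0; split=> //; first by move=> a x y; rewrite !zeroE scaler0 addr0.
  move=> x; have := sublinear_ge x qs; have := qM (- x).
  by rewrite big_nil mulr0 zeroE; lra.
have lg : linear g by apply: lfs; rewrite mem_head.
have Gg : G g by apply: Gfs; rewrite mem_head.
have lfs' h : h \in fs -> linear h by move=> hfs; apply: lfs; rewrite inE hfs orbT.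
have Gfs' h : h \in fs -> G h by move=> hfs; apply: Gfs; rewrite inE hfs orbT.
have [[e [eker ge]]|noe] :=
    pselect (exists e, (forall h, h \in fs -> h e = 0) /\ g e <> 0).
  have ge' : g e != 0 by apply/eqP.
  pose c := linearize q e e / g e.
  pose q' x := linearize q e x - c * g x.
  have [lD lZ] := linearize_sublinear e qs.
  have q's : sublinear q'.
    split=> [x y|a x a0]; rewrite /q'.
      by rewrite (linear_funD lg); have := lD x y; lra.
    by rewrite (linear_funZ lg) lZ//; ring.
  have q'M x : q' x <= M * \sum_(h <- fs) `|h x|.
    (* [q'] is invariant under translation along [e]; this translation moves [x] into the kernel of
       [g] and leaves every [h x] of the tail unchanged. *)
    have -> : q' x = linearize q e (x + (- (g x / g e)) *: e).
      by rewrite linearizeE// /q' /c; field.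
    apply: le_trans (linearize_le e qs _) _; apply: le_trans (qM _) _.
    rewrite big_cons linear_funD// linear_funZ//.
    rewrite mulNr divfK// subrr normr0 add0r.
    rewrite le_eqVlt; apply/orP; left; apply/eqP; congr (_ * _).
    apply: eq_big_seq => h hfs; have lh := lfs' _ hfs.
    by rewrite linear_funD// linear_funZ// (eker h)// mulr0 addr0.
  have [f [Gf lf fq']] := IH q' M lfs' Gfs' q's M0 q'M.
  exists (f + c *: g); split.
  - by apply: (GD) => //; exact: GZ.
  - by move=> a x y; rewrite !fctE lf lg /GRing.scale/=; ring.
  - move=> x; apply: le_trans (linearize_le e qs x).
    by rewrite !fctE; have := fq' x; rewrite /q' /GRing.scale/=; lra.
(* Here [g] vanishes on the common kernel of the tail, so its term is absorbed by enlarging the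
   constant. *)
have [C C0 gC] : exists2 C : R, 0 <= C & forall x, `|g x| <= C * \sum_(h <- fs) `|h x|.
  apply: le_span_of_ker => // x xker.
  by apply: contrapT => gx; apply: noe; exists x.
apply: (IH q (M * (C + 1))) => //.
  by rewrite mulr_ge0// addr_ge0.
move=> x; apply: le_trans (qM x) _; rewrite big_cons -mulrA ler_wpM2l//.
by rewrite mulrDl mul1r lerD2r.
Qed.

(** A functional below [linearize q e] satisfies [f (- e) <= - q e], so domination there already
    yields support at [e]. *)
Lemma finite_hahn_banach_support (G : set (V -> R^o)) (fs : seq (V -> R^o)) q (M : R) e :
  functional_subspace G -> (forall h, h \in fs -> linear h) ->
  (forall h, h \in fs -> G h) -> sublinear q -> 0 <= M ->
  (forall x, q x <= M * \sum_(h <- fs) `|h x|) ->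
  exists f, [/\ G f, linear f, forall x, f x <= q x & q e <= f e].
Proof.
move=> Gs lfs Gfs qs M0 qM.
have [||f [Gf lf fq]] :=
    @finite_hahn_banach G fs (linearize q e) M Gs lfs Gfs _ M0.
- exact: linearize_sublinear.
- by move=> x; apply: le_trans (qM x); exact: linearize_le.
exists f; split=> //; first by move=> x; apply: le_trans (fq x) _; exact: linearize_le.
have := fq (- e); have := linearize_opp e qs; rewrite (linear_funN lf); lra.
Qed.

End Sublinear.

(** * Lower semicontinuity and the topology sigma(X,F) *)

Lemma cvg_initial (S : choiceType) (T : topologicalType) (f : S -> T)
    (G : set_system S) (s : S) : Filter G ->
  f @ G --> f s -> G --> (s : initial_topology f).
Proof.
move=> FG fG A [_ [[B Bo <-] Bs] BA].
have GB : G (f @^-1` B) := fG B (open_nbhs_nbhs (conj Bo Bs)).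
exact: filterS BA GB.
Qed.

Section RealLsc.
Context {R : realType} {T : topologicalType}.
Implicit Types s t : T -> R.

Definition lsc s := forall x (a : R), a < s x -> \forall y \near x, a < s y.

Lemma lsc_cst (c : R) : lsc (fun=> c).
Proof. by move=> x a ac; apply: nearW. Qed.

Lemma lscD s t : lsc s -> lsc t -> lsc (fun x => s x + t x).
Proof.
move=> hs ht x a axst; pose e := (s x + t x - a) / 2.
have e0 : 0 < e by rewrite /e; lra.
have : s x - e < s x by lra.
move=> /hs; have : t x - e < t x by lra.
move=> /ht; apply: filterS2 => y /=; rewrite /e; lra.
Qed.

Lemma lscZ (c : R) s : 0 <= c -> lsc s -> lsc (fun x => c * s x).
Proof.
rewrite le_eqVlt => /predU1P[<- _|c0 ls].
  by move=> x a; rewrite mul0r => a0; apply: nearW => y; rewrite mul0r.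
move=> x a; rewrite -ltr_pdivrMl// => /ls.
by apply: filterS => y; rewrite ltr_pdivrMl.
Qed.

Lemma lsc_sum (u : nat -> T -> R) n : (forall k, lsc (u k)) ->
  lsc (fun x => \sum_(k < n) u k x).
Proof.
move=> lu; elim: n => [|n IH].
  rewrite (_ : (fun x => _) = fun=> 0); first exact: lsc_cst.
  by apply/funext => x; rewrite big_ord0.
rewrite (_ : (fun x => _) = fun x => \sum_(k < n) u k x + u n x).
  exact: lscD.
by apply/funext => x; rewrite big_ord_recr.
Qed.

Lemma lsc_sup (I : Type) (D : set I) (u : I -> T -> R) :
  D !=set0 -> (forall x, has_ubound [set u i x | i in D]) ->
  (forall i, D i -> lsc (u i)) -> lsc (fun x => sup [set u i x | i in D]).
Proof.
move=> [i0 Di0] bu lu x a /sup_gt[]; first by exists (u i0 x), i0.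
move=> _ [i Di <-] /(lu i Di); apply: filterS => y ay.
by apply: lt_le_trans ay _; apply: ub_le_sup => //; exists i.
Qed.

Lemma lsc_max s t : lsc s -> lsc t -> lsc (fun x => Num.max (s x) (t x)).
Proof.
move=> hs ht x a; rewrite lt_max => /orP[/hs|/ht]; apply: filterS => y ay.
  by rewrite lt_max ay.
by rewrite lt_max ay orbT.
Qed.

Lemma lsc_sqr (p : T -> R) : (forall x, 0 <= p x) -> lsc p -> lsc (fun x => p x ^+ 2).
Proof.
move=> p0 lp x a; have [a0 apx|a0 _] := leP 0 a; last first.
  by apply: nearW => y; apply: lt_le_trans a0 _; exact: sqr_ge0.
have : Num.sqrt a < p x.
  by rewrite -[p x]ger0_norm// -sqrtr_sqr ltr_sqrt// (le_lt_trans a0).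
move=> /lp; apply: filterS => y ay; rewrite -[a]sqr_sqrtr//.
by rewrite ltrXn2r// ?nnegrE ?sqrtr_ge0.
Qed.

Lemma lsc_sqrt s : (forall x, 0 <= s x) -> lsc s ->
  lsc (fun x => Num.sqrt (s x)).
Proof.
move=> s0 ls x a; have [a0 ax|a0 _] := leP 0 a; last first.
  by apply: nearW => y; apply: lt_le_trans a0 _; exact: sqrtr_ge0.
have : a ^+ 2 < s x by rewrite -[s x]sqr_sqrtr// ltrXn2r// ?nnegrE ?sqrtr_ge0.
move=> /ls; apply: filterS => y ay.
by rewrite -[a]ger0_norm// -sqrtr_sqr ltr_sqrt// (le_lt_trans _ ay)// sqr_ge0.
Qed.

End RealLsc.

(** * Convergence and basic neighbourhoods in sigma(X,F) *)

Section SigmaTopology.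
Context {R : realType} {X : normedModType R} (F : set (X -> R^o)).
Implicit Types (N : X -> R) (x y : X).

Lemma sigma_cvgP (G : set_system X) x : Filter G ->
  G --> (x : sigma_space F) <->
  forall f, F f -> f @ G --> (f x : R^o).
Proof.
move=> FG; split=> [Gx f Ff|Gx].
  have Ff' := mem_set Ff; pose i : F := SigSub Ff'.
  have H : {ptws, @sigma_eval _ _ F @ G --> @sigma_eval _ _ F x}.
    apply: cvg_trans (@initial_continuous _ _ (@sigma_eval _ _ F) x).
    exact: cvg_app.
  have pc := @proj_continuous (set_type F) (fun=> R^o) i (@sigma_eval _ _ F x).
  exact: cvg_trans (cvg_app (proj i) H) pc.
apply: (@cvg_initial _ _ (@sigma_eval _ _ F)); apply/cvg_sup => -[f Ff].
apply: cvg_initial; exact: Gx (set_mem Ff).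
Qed.

Lemma sigma_continuous_functional f x : F f ->
  f @ (nbhs (x : sigma_space F)) --> (f x : R^o).
Proof.
exact: (sigma_cvgP x (nbhs_filter (x : sigma_space F))).1 (@cvg_id _ _) f.
Qed.

Lemma sigma_nbhs_base x (V : set X) : nbhs (x : sigma_space F) V ->
  exists (fs : seq (X -> R^o)) (e : R),
    [/\ 0 < e, forall f, f \in fs -> F f &
        [set y | \sum_(f <- fs) `|f y - f x| < e] `<=` V].
Proof.
pose D := [set p : seq (X -> R^o) * R | 0 < p.2 /\ forall f, f \in p.1 -> F f].
pose U (p : seq (X -> R^o) * R) := [set y | \sum_(f <- p.1) `|f y - f x| < p.2].
have FG : Filter (filter_from D U).
  apply: filter_from_filter; first by exists ([::], 1).
  move=> [fs e] [gs d] [/= e0 Ffs] [/= d0 Fgs].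
  exists (fs ++ gs, Num.min e d).
    split=> /=; first by rewrite lt_min e0.
    by move=> f; rewrite mem_cat => /orP[/Ffs|/Fgs].
  move=> y; rewrite /U /= big_cat/= lt_min => /andP[He Hd]; split.
    by apply: le_lt_trans He; rewrite lerDl sumr_ge0.
  by apply: le_lt_trans Hd; rewrite lerDr sumr_ge0.
suff H : filter_from D U --> (x : sigma_space F).
  by move=> /H [[fs e] [/= e0 Ffs] sub]; exists fs, e.
apply: (sigma_cvgP x FG).2 => f Ff; apply/cvgrPdist_lt => e e0.
exists ([:: f], e) => /=; first by split=> //= g; rewrite inE => /eqP ->.
by move=> y; rewrite /U /= big_seq1 distrC.
Qed.

Hypothesis dF : F `<=` dual_space.

Lemma sigma_continuous_scaleD (a : R) x y :
  (fun z : X => a *: z + x) @ nbhs (y : sigma_space F)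
    --> (a *: y + x : sigma_space F).
Proof.
apply: (sigma_cvgP (a *: y + x) _).2 => f Ff.
have [lf _] := dF Ff.
rewrite (linear_funD lf) (linear_funZ lf).
apply: (@cvg_trans _ ((fun z => a * f z + f x : R^o) @ nbhs (y : sigma_space F))).
  move=> A /= HA; apply: (@filterS _ (nbhs (y : sigma_space F)) _ _ _ _ HA) => z.
  by rewrite /= (linear_funD lf) (linear_funZ lf).
apply: cvgD; last exact: cvg_cst.
by apply: cvgM; [exact: cvg_cst|exact: sigma_continuous_functional].
Qed.

Lemma sigma_lscP N : sigma_lsc F N <-> @lsc R (sigma_space F) N.
Proof.
split=> [H x a ax|H x a ax].
  have [] := H x a; first by rewrite lte_fin.
  by move=> V Vx Va; apply: filterS Vx => y /Va; rewrite lte_fin.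
by exists [set y | a < N y]; [apply: H; rewrite -lte_fin|].
Qed.

End SigmaTopology.

(** * Norms and their spheres *)

Section NormFacts.
Context {R : realType} {X : normedModType R}.
Implicit Types (N : X -> R) (x y : X).

Lemma is_norm_sublinear N : is_norm N -> sublinear N.
Proof. by case=> ND NZ _; split=> // a x a0; rewrite NZ ger0_norm. Qed.

Lemma is_normN N x : is_norm N -> N (- x) = N x.
Proof. by case=> _ NZ _; rewrite -scaleN1r NZ normrN1 mul1r. Qed.

Lemma is_norm_ge0 N x : is_norm N -> 0 <= N x.
Proof.
by move=> nN; have := sublinear_ge x (is_norm_sublinear nN); rewrite is_normN//; lra.
Qed.

Lemma is_norm_eq0 N x : is_norm N -> N x = 0 <-> x = 0.
Proof.
move=> nN; split=> [|->]; first by case: nN => _ _; apply.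
exact: sublinear0 (is_norm_sublinear nN).
Qed.

Lemma is_norm_double N x : is_norm N -> N (x + x) = 2 * N x.
Proof. by case=> _ NZ _; rewrite -mulr2n -scaler_nat NZ ger0_norm. Qed.

Lemma sum_norm_sublinear (fs : seq (X -> R^o)) (M : R) : 0 <= M ->
  (forall f, f \in fs -> linear f) ->
  sublinear (fun x => M * \sum_(f <- fs) `|f x|).
Proof.
move=> M0 lfs; split=> [x y|a x a0].
  rewrite -mulrDr ler_wpM2l// -big_split/= big_seq [leRHS]big_seq.
  by apply: ler_sum => f /lfs lf; rewrite (linear_funD lf) ler_normD.
rewrite mulrCA; congr (_ * _); rewrite mulr_sumr; apply: eq_big_seq => f /lfs lf.
by rewrite (linear_funZ lf) normrM ger0_norm.
Qed.

End NormFacts.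

(** * Supporting functionals from a norming subspace, and the topology of spheres *)

Section Sphere.
Context {R : realType} {X : normedModType R} (F : set (X -> R^o)).
Implicit Types (N : X -> R) (x y : X).
Hypothesis nF : norming_subspace F.

Lemma norming_dual : F `<=` dual_space.
Proof. by case: nF => -[]. Qed.

Lemma norming_linear f : F f -> linear f.
Proof. by move=> /norming_dual[]. Qed.

Lemma norming_functional_subspace : functional_subspace F.
Proof. by case: nF => -[]. Qed.

Lemma norming_separates x : (forall f, F f -> f x = 0) -> x = 0.
Proof.
case: nF => _ [_ [[_ _ N0] _]] Fx; apply: N0 => /=.
(* The supremum of the empty set is 0 by default, so both cases give a vanishing norm. *)
have [E0|/set0P E0] := eqVneq [set `|b x| | b in F `&` dual_ball] set0.
  by rewrite E0 sup0.
rewrite (_ : [set `|b x| | b in F `&` dual_ball] = [set 0]) ?sup1//.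
apply/seteqP; split=> [_ [f [Ff _] <-]|_ ->] /=; first by rewrite Fx// normr0.
by case: E0 => a [f [Ff Bf] _]; exists f => //; rewrite Fx// normr0.
Qed.

Lemma supporting_functional N x (d : R) : is_norm N -> sigma_lsc F N ->
  d < N x -> exists f, [/\ F f, forall y, f y <= N y & d <= f x].
Proof.
move=> nN /sigma_lscP lN dx.
have [fs [e [e0 Ffs sub]]] := sigma_nbhs_base (lN _ _ dx).
have lfs f : f \in fs -> linear f by move=> /Ffs /norming_linear.
(* With this [M], [P (x - y) >= |d|] for [y] outside the neighbourhood, while [N y > d] inside it;
   hence the infimal convolution is at least [d] at [x]. *)
pose M := `|d| / e; have M0 : 0 <= M by rewrite divr_ge0// ltW.
pose P x := M * \sum_(f <- fs) `|f x|.
have Ps : sublinear P by exact: sum_norm_sublinear.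
have P0 y : 0 <= P y by rewrite mulr_ge0// sumr_ge0.
have Ns := is_norm_sublinear nN.
have N0 y : 0 <= N y by exact: is_norm_ge0.
pose q := inf_conv N P.
have [|x'|f [Ff lf fq qf]] := @finite_hahn_banach_support _ _ F fs q M x
    norming_functional_subspace lfs Ffs _ M0 _.
- exact: inf_conv_sublinear.
- exact: inf_conv_ler.
exists f; split=> //.
  by move=> y; apply: le_trans (fq y) _; exact: inf_conv_lel.
apply: le_trans qf; apply: inf_conv_ge => // y.
have [ye|ye] := ltP (\sum_(f <- fs) `|f y - f x|) e.
  by have /= := sub _ ye; have := P0 (x - y); lra.
apply: (@le_trans _ _ (P (x - y))); last by rewrite lerDr.
apply: (@le_trans _ _ (M * e)).
  by rewrite /M divfK ?gt_eqF// ler_norm.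
rewrite ler_wpM2l//; apply: le_trans ye _.
rewrite big_seq [leRHS]big_seq; apply: ler_sum => h /lfs lh.
by rewrite (linear_funB lh) distrC.
Qed.

Lemma sphere_nbhsP N (x : sigma_sphere F N) (W : set (sigma_sphere F N)) :
  nbhs x W <-> exists2 V : set X, nbhs (set_val x : sigma_space F) V &
    forall y : sigma_sphere F N, V (set_val y) -> W y.
Proof.
split=> [[_ [[V Vo <-] Vx] VW]|[V Vx VW]].
  by exists V => //; exact: open_nbhs_nbhs.
have : nbhs x (set_val @^-1` V).
  exact: (@initial_continuous _ (sigma_space F) set_val x) V Vx.
exact: filterS.
Qed.

Lemma sphere_slice_open N (D : set (sigma_sphere F N)) : sphere_slice D -> open D.
Proof.
move=> [f [alpha [Ff _ ->]]]; rewrite openE => x /= ax.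
apply/sphere_nbhsP; exists [set z | f z > alpha] => //.
have H := @sigma_continuous_functional _ _ F f (set_val x) Ff.
exact: H [set t : R | alpha < t] (lt_nbhsr ax).
Qed.

End Sphere.

(** * Slices of small diameter *)

Section SlicesToDevelopment.
Context {R : realType} {X : normedModType R} (F : set (X -> R^o)).
Hypothesis nF : norming_subspace F.

Lemma small_slices_development N
    (rho : sigma_sphere F N -> sigma_sphere F N -> R) :
  symmetrized_by rho ->
  (forall (x : sigma_sphere F N) (e : R), 0 < e ->
     exists D : set (sigma_sphere F N),
       [/\ sphere_slice D, D x & (rho_diameter rho D < e%:E)%E]) ->
  exists G : nat -> set (set (sigma_sphere F N)),
    development G /\ forall n D, G n D -> sphere_slice D.
Proof.
move=> rs small.
pose G (n : nat) := [set D : set (sigma_sphere F N) |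
  sphere_slice D /\ (rho_diameter rho D < (n.+1%:R^-1)%:E)%E].
exists G; split; last by move=> n D [].
have Go n D : G n D -> open D by move=> [/sphere_slice_open].
have Gx n x : exists2 D, G n D & D x.
  have [|D [sD Dx dD]] := small x n.+1%:R^-1; first by rewrite invr_gt0.
  by exists D.
split=> [n|x].
  split; first exact: Go.
  by apply/seteqP; split=> // x _; have [D GD Dx] := Gx n x; exists D.
split=> [n|W].
  have [D GD Dx] := Gx n x.
  have : nbhs x D by apply: open_nbhs_nbhs; split=> //; exact: Go GD.
  by apply: filterS => y Dy; exists D.
rewrite nbhsE => -[U [Uo Ux] UW].
have [e e0 eU] := (rs U).1 Uo x Ux.
(* Every slice of the [n]-th covering through [x] then has diameter below [e], so the whole star
   lies in the [rho]-ball of radius [e]. *)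
have [n _ ne] := near_infty_natSinv_lt (PosNum e0).
exists n => y [D [[_ dD] Dx] Dy]; apply: UW; apply: eU.
have {}ne := ne n (leqnn n).
rewrite /rho_ball /= -lte_fin.
apply: (@le_lt_trans _ _ (rho_diameter rho D)).
  by apply: ereal_sup_ubound; exists x => //; exists y.
by apply: (lt_trans dD); rewrite lte_fin.
Qed.

End SlicesToDevelopment.

(** * The symmetric of a LUR norm *)

Section LURToSlices.
Context {R : realType} {X : normedModType R} (F : set (X -> R^o)).
Variable N : X -> R.
Hypotheses (nF : norming_subspace F) (nN : is_norm N).
Hypotheses (lN : sigma_lsc F N) (rN : sigma_LUR F N).

Let rho (x y : sigma_sphere F N) : R := 2 - N (set_val x + set_val y).

Let sphereP (x : sigma_sphere F N) : N (set_val x) = 1.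
Proof. exact: (set_valP x). Qed.

Let rho_ge0 x y : 0 <= rho x y.
Proof.
case: nN => ND _ _; have := ND (set_val x) (set_val y).
by rewrite /rho !sphereP; lra.
Qed.

Let LUR_gap x y : 2 * N (set_val x) ^+ 2 + 2 * N (set_val y) ^+ 2
  - N (set_val x + set_val y) ^+ 2 = rho x y * (4 - rho x y).
Proof. by rewrite /rho !sphereP; ring. Qed.

(** If [rho x y = 0], the LUR gap vanishes along the constant sequence [y], which therefore
    converges to [x]; since [F] separates points, [x = y]. *)
Lemma LUR_symmetric : symmetric_fun rho.
Proof.
split=> // x y; first by rewrite /rho [set_val y + _]addrC.
split=> [rxy|->]; last by rewrite /rho is_norm_double// sphereP; ring.
apply: val_inj; apply/eqP; rewrite -subr_eq0; apply/eqP.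
apply: (norming_separates nF) => f Ff; rewrite (linear_funB (norming_linear nF Ff)).
have yx : (fun _ : nat => set_val y) @ \oo --> (set_val x : sigma_space F).
  by apply: rN; under eq_fun do rewrite LUR_gap rxy mul0r; exact: cvg_cst.
have FF : Filter ((fun _ : nat => set_val y : X) @ \oo) by exact: fmap_filter.
have fyx := (sigma_cvgP F (set_val x) FF).1 yx f Ff.
have := cvg_unique _ fyx (@cvg_cst _ (f (set_val y)) _ _ _).
by move=> E; apply/eqP; rewrite subr_eq0; apply/eqP; exact: E.
Qed.

Lemma LUR_symmetrized : symmetrized_by rho.
Proof.
move=> U; split=> [Uo x Ux|Ub].
  apply: contrapT => noe.
  have /choice[u uP] n : exists y, rho x y < n.+1%:R^-1 /\ ~ U y.
    apply: contrapT => H; apply: noe; exists n.+1%:R^-1; first by rewrite invr_gt0.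
    by move=> y xy; apply: contrapT => Uy; apply: H; exists y.
  have [V Vx VU] := (sphere_nbhsP x U).1 (open_nbhs_nbhs (conj Uo Ux)).
  have : (fun n => 2 * N (set_val x) ^+ 2 + 2 * N (set_val (u n)) ^+ 2 -
      N (set_val x + set_val (u n)) ^+ 2) @ \oo --> (0 : R).
    under eq_fun do rewrite LUR_gap.
    (* The gap [rho * (4 - rho)] lies between 0 and [4 * rho], because [rho <= 2]. *)
    apply: (@squeeze_cvgr _ _ _ _ (fun=> 0) (fun n => 4 * n.+1%:R^-1)).
    - near=> n; have := rho_ge0 x (u n); have [h _] := uP n => r0.
      have : rho x (u n) <= 2.
        by rewrite /rho; have := is_norm_ge0 (set_val x + set_val (u n)) nN; lra.
      move=> r2; move: h r0 r2; set r := rho _ _; set k := _^-1 => h r0 r2.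
      rewrite mulr_ge0//=; last by lra.
      by have := sqr_ge0 r; rewrite expr2; lra.
    - exact: cvg_cst.
    - rewrite -[X in _ --> X](mulr0 (4 : R)); apply: cvgM; first exact: cvg_cst.
      exact: cvg_harmonic.
  move=> /rN /(_ _ Vx) [n _ /(_ n (leqnn n)) /= Vn].
  by have [_] := uP n; apply; exact: VU.
rewrite openE => x Ux; have [e e0 eU] := Ub x Ux.
apply/sphere_nbhsP.
(* Lower semicontinuity of [N] at [x + x], where its value is 2, makes the [rho]-ball a
   neighbourhood. The factor [1 *:] matches [sigma_continuous_scaleD]. *)
exists [set z | 2 - e < N (1 *: z + set_val x)]; last first.
  by move=> y; rewrite /= scale1r => H; apply: eU; rewrite /rho_ball /= /rho [_ + set_val y]addrC; lra.
have H := @sigma_continuous_scaleD _ _ F (norming_dual nF) 1 (set_val x) (set_val x).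
have l : 2 - e < N (1 *: set_val x + set_val x).
  by rewrite scale1r is_norm_double// sphereP; lra.
exact: H _ ((sigma_lscP F N).1 lN _ _ l).
Unshelve. all: by end_near. Qed.

Lemma LUR_small_slices (x : sigma_sphere F N) (e : R) : 0 < e ->
  exists D : set (sigma_sphere F N),
    [/\ sphere_slice D, D x & (rho_diameter rho D < e%:E)%E].
Proof.
(* Two points with [f > 1 - 2 * d] satisfy [N (y + z) > 2 - 4 * d], so the diameter is at most
   [4 * d <= e / 2]. The cap [1 / 2] keeps [f x] positive, hence [f <> 0]. *)
move=> e0; pose d := Num.min (e / 8) (1 / 2).
have d0 : 0 < d by rewrite lt_min !divr_gt0.
have de : d <= e / 8 by rewrite ge_min lexx.
have d1 : d <= 1 / 2 by rewrite ge_min lexx orbT.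
have [|f [Ff fN fx]] := @supporting_functional _ _ F nF N (set_val x) (1 - d) nN lN.
  by rewrite sphereP; lra.
exists [set y | 1 - 2 * d < f (set_val y)]; split.
- exists f, (1 - 2 * d); split=> // f0.
  have : f (set_val x) = 0 by rewrite f0.
  by move: fx => /[swap] ->; lra.
- by move=> /=; lra.
- apply: (@le_lt_trans _ _ (4 * d)%:E); last by rewrite lte_fin; lra.
  apply: ge_ereal_sup => _ [y /= ay [z /= az <-]]; rewrite lee_fin /rho.
  have := fN (set_val y + set_val z).
  by rewrite (linear_funD (norming_linear nF Ff)); lra.
Qed.

End LURToSlices.

(** * Square sums of sublinear functionals *)

Section QuadraticFunctions.
Context {R : realType} {X : normedModType R} (F : set (X -> R^o)).
Implicit Types (s t : X -> R) (p : X -> R).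

(* Quadratic form of the triangle inequality: unlike the subadditivity of
   [Num.sqrt \o s], it is visibly preserved by sums and suprema. *)
Definition sqr_subadditive s := forall (l m : R) x y,
  0 < l -> 0 < m -> l + m = 1 -> s (x + y) <= s x / l + s y / m.

Lemma sqr_subadditive_sqr p : (forall x, 0 <= p x) -> sublinear p ->
  sqr_subadditive (fun x => p x ^+ 2).
Proof.
move=> p0 [pD _] l m x y l0 m0 lm.
apply: (@le_trans _ _ ((p x + p y) ^+ 2)).
  by rewrite lerXn2r ?nnegrE ?addr_ge0.
have -> : m = 1 - l by lra.
rewrite -subr_ge0.
have -> : p x ^+ 2 / l + p y ^+ 2 / (1 - l) - (p x + p y) ^+ 2 =
    ((1 - l) * p x - l * p y) ^+ 2 / (l * (1 - l)).
  by field; apply/andP; split; apply/eqP; lra.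
by rewrite divr_ge0 ?sqr_ge0// mulr_ge0//; lra.
Qed.

Lemma sqr_subadditiveD s t : sqr_subadditive s -> sqr_subadditive t ->
  sqr_subadditive (fun x => s x + t x).
Proof.
move=> ss st l m x y l0 m0 lm; have := ss l m x y l0 m0 lm.
by have := st l m x y l0 m0 lm; lra.
Qed.

Lemma sqr_subadditiveZ (c : R) s : 0 <= c -> sqr_subadditive s ->
  sqr_subadditive (fun x => c * s x).
Proof.
move=> c0 ss l m x y l0 m0 lm; have := ss l m x y l0 m0 lm.
by move=> /(ler_wpM2l c0); rewrite mulrDr !mulrA.
Qed.

Lemma sqr_subadditiveN s : sqr_subadditive s ->
  sqr_subadditive (fun x => s (- x)).
Proof. by move=> ss l m x y; rewrite opprD; exact: ss. Qed.

Lemma sqr_subadditive_sum (u : nat -> X -> R) n :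
  (forall k, sqr_subadditive (u k)) ->
  sqr_subadditive (fun x => \sum_(k < n) u k x).
Proof.
move=> su; elim: n => [|n IH] l m x y l0 m0 lm.
  by rewrite !big_ord0 !mul0r addr0.
rewrite !big_ord_recr /=.
exact: (sqr_subadditiveD IH (su n)).
Qed.

Lemma sqrt_subadditive s : (forall x, 0 <= s x) -> (forall x, s x = 0 -> x = 0) ->
  sqr_subadditive s ->
  forall x y, Num.sqrt (s (x + y)) <= Num.sqrt (s x) + Num.sqrt (s y).
Proof.
move=> s0 sx0 ss x y.
have sN z : z != 0 -> 0 < Num.sqrt (s z).
  move=> z0; rewrite sqrtr_gt0 lt_def s0 andbT; apply/eqP => /sx0 /eqP.
  exact/negP.
have [->|x0] := eqVneq x 0; first by rewrite add0r lerDr sqrtr_ge0.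
have [->|y0] := eqVneq y 0; first by rewrite addr0 lerDl sqrtr_ge0.
set a := Num.sqrt (s x); set b := Num.sqrt (s y).
have a0 : 0 < a := sN _ x0; have b0 : 0 < b := sN _ y0.
have ab : 0 <= a + b by rewrite addr_ge0 ?ltW.
rewrite -[leRHS]ger0_norm// -sqrtr_sqr ler_wsqrtr//.
(* These weights minimise [a ^+ 2 / l + b ^+ 2 / m] and give exactly [(a + b) ^+ 2]. *)
apply: le_trans (ss (a / (a + b)) (b / (a + b)) x y _ _ _) _.
- by rewrite divr_gt0// addr_gt0.
- by rewrite divr_gt0// addr_gt0.
- by rewrite -mulrDl divff// gt_eqF// addr_gt0.
rewrite -[s x]sqr_sqrtr// -[s y]sqr_sqrtr// -/a -/b.
have ab0 : a + b != 0 by rewrite gt_eqF// addr_gt0.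
rewrite le_eqVlt; apply/orP; left; apply/eqP; field.
by rewrite (gt_eqF a0) (gt_eqF b0) ab0.
Qed.

Lemma lsc_opp s : F `<=` dual_space -> @lsc R (sigma_space F) s ->
  @lsc R (sigma_space F) (fun x => s (- x)).
Proof.
move=> dF ls x a ax.
have H := @sigma_continuous_scaleD _ _ F dF (-1) 0 x.
have ax' : a < s (-1 *: x + 0) by rewrite addr0 scaleN1r.
apply: (@filterS _ (nbhs (x : sigma_space F)) _ _ _ _ (H _ (ls _ _ ax'))) => y /=.
by rewrite addr0 scaleN1r.
Qed.

End QuadraticFunctions.

(** * Renorming by a weighted sum of squares *)

Section SquareSum.
Context {R : realType} {X : normedModType R} (F : set (X -> R^o)).
Variables (N : X -> R) (p : nat -> X -> R) (C : R).
Hypotheses (dF : F `<=` dual_space) (eN : equivalent_norm N) (C0 : 0 < C).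
Hypotheses (pN : p 0%N = N) (ps : forall k, sublinear (p k)).
Hypotheses (p0 : forall k x, 0 <= p k x) (pC : forall k x, p k x <= C * N x).
Hypothesis (lp : forall k, @lsc R (sigma_space F) (p k)).

Let nN : is_norm N. Proof. by case: eN. Qed.

Let w k : R := (1 / 2) ^+ k.+1.

(** The [p k] are only positively homogeneous; adding the reflected square makes the sum even. *)
Let v k x := p k x ^+ 2 + p k (- x) ^+ 2.

Let Sq K x := \sum_(k < K) w k * v k x.

(** The series is taken as a supremum of partial sums, so that lower semicontinuity and
    [sqr_subadditive] pass to it directly. *)
Let S x := sup [set Sq K x | K in [set: nat]].

Let gap (s : X -> R) x y := 2 * s x + 2 * s y - s (x + y).

Let w_gt0 k : 0 < w k. Proof. by rewrite exprn_gt0// divr_gt0. Qed.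

Let v_ge0 k x : 0 <= v k x. Proof. by rewrite addr_ge0// sqr_ge0. Qed.

Let Sq_le K x : Sq K x <= (1 - (1 / 2) ^+ K) * (2 * C ^+ 2 * N x ^+ 2).
Proof.
elim: K => [|K IH]; first by rewrite /Sq big_ord0 expr0 subrr mul0r.
rewrite /Sq big_ord_recr /= -/(Sq K x).
have vB : v K x <= 2 * C ^+ 2 * N x ^+ 2.
  have pz z : p K z ^+ 2 <= C ^+ 2 * N z ^+ 2.
    by rewrite -exprMn lerXn2r ?nnegrE// (le_trans (p0 K z) (pC K z)).
  by have := pz x; have := pz (- x); rewrite (is_normN x nN) /v; lra.
have := ler_wpM2l (ltW (w_gt0 K)) vB.
by move: IH; rewrite /w !exprS; set e := _ ^+ K; set B := 2 * _ * _; lra.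
Qed.

Let B_ge0 x : 0 <= 2 * C ^+ 2 * N x ^+ 2.
Proof. by rewrite mulr_ge0 ?sqr_ge0// mulr_ge0 ?sqr_ge0. Qed.

Let Sq_leB K x : Sq K x <= 2 * C ^+ 2 * N x ^+ 2.
Proof.
apply: le_trans (Sq_le K x) _; rewrite ler_piMl// gerBl exprn_ge0//.
Qed.

Let Sq_ub x : has_ubound [set Sq K x | K in [set: nat]].
Proof. by exists (2 * C ^+ 2 * N x ^+ 2) => _ [K _ <-]. Qed.

Let Sq_ne x : [set Sq K x | K in [set: nat]] !=set0.
Proof. by exists (Sq 0 x), 0%N. Qed.

Let Sq_leS K x : Sq K x <= S x.
Proof. by apply: ub_le_sup => //; exists K. Qed.

Let S_leP x b : (forall K, Sq K x <= b) -> S x <= b.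
Proof. by move=> H; apply: ge_sup => // _ [K _ <-]. Qed.

Let S_leB x : S x <= 2 * C ^+ 2 * N x ^+ 2.
Proof. exact: S_leP. Qed.

Let S_geN x : N x ^+ 2 <= S x.
Proof.
(* The first term is [1 / 2 * (N x ^+ 2 + N (- x) ^+ 2) = N x ^+ 2]. *)
apply: le_trans (Sq_leS 1 x).
by rewrite /Sq big_ord_recr big_ord0 /= /w /v pN (is_normN x nN) expr1; lra.
Qed.

Let S_ge0 x : 0 <= S x.
Proof. exact: le_trans (sqr_ge0 _) (S_geN x). Qed.

Let SZ (a : R) x : S (a *: x) = a ^+ 2 * S x.
Proof.
have vZ b k z : v k (b *: z) = b ^+ 2 * v k z.
  have [b0|b0] := leP 0 b.
    by rewrite /v -scalerN !(ps k).2// !exprMn mulrDr.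
  (* A negative scalar merely exchanges the two squares in [v]. *)
  have bN y : b *: y = (- b) *: - y by rewrite scalerN scaleNr opprK.
  rewrite /v -scalerN !bN opprK !(ps k).2 ?oppr_ge0 ?(ltW b0)//.
  by rewrite !exprMn sqrrN -mulrDr addrC.
have Sle b z : S (b *: z) <= b ^+ 2 * S z.
  apply: S_leP => K; apply: (@le_trans _ _ (b ^+ 2 * Sq K z)).
    by rewrite /Sq mulr_sumr; apply: ler_sum => k _; rewrite vZ mulrCA.
  by rewrite ler_wpM2l// sqr_ge0.
apply/le_anti; rewrite Sle/=.
have [->|a0] := eqVneq a 0; first by rewrite expr0n mul0r.
have a2 : 0 < a ^+ 2 by rewrite exprn_even_gt0.
by rewrite -ler_pdivlMl// -exprVn -[in leLHS](scalerK a0 x).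
Qed.

Let S_sqr_subadditive : sqr_subadditive S.
Proof.
have su K : sqr_subadditive (Sq K).
  apply: (@sqr_subadditive_sum R X (fun k x => w k * v k x)) => k.
  apply: sqr_subadditiveZ; first exact: ltW.
  apply: sqr_subadditiveD; first exact: sqr_subadditive_sqr.
  exact: (sqr_subadditiveN (sqr_subadditive_sqr (p0 k) (ps k))).
move=> l m x y l0 m0 lm; apply: S_leP => K.
apply: le_trans (su K l m x y l0 m0 lm) _.
by apply: lerD; rewrite ler_wpM2r// invr_ge0 ltW.
Qed.

Let gap_sqr k x y : (p k x - p k y) ^+ 2 <= gap (fun z => p k z ^+ 2) x y.
Proof.
rewrite /gap; have : p k (x + y) ^+ 2 <= (p k x + p k y) ^+ 2.
  by rewrite lerXn2r ?nnegrE ?addr_ge0//; exact: (ps k).1.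
by rewrite sqrrB sqrrD; lra.
Qed.

Let gap_sqr_ge0 k x y : 0 <= gap (fun z => p k z ^+ 2) x y.
Proof. exact: le_trans (sqr_ge0 _) (gap_sqr k x y). Qed.

(** The gap is additive over the terms of the sum and each term has a nonnegative gap, so the [k]-th
    one alone is bounded by the total. This decouples the LUR condition into one condition for each
    [p k]. *)
Let gap_le k x y : w k * gap (fun z => p k z ^+ 2) x y <= gap S x y.
Proof.
suff : S (x + y) <= 2 * S x + 2 * S y - w k * gap (fun z => p k z ^+ 2) x y.
  by rewrite [gap S x y]/gap; lra.
have gv i : gap (v i) x y = gap (fun z => p i z ^+ 2) x y
    + gap (fun z => p i z ^+ 2) (- x) (- y).
  by rewrite /gap /v [- (x + y)]opprD /=; ring.
(* [L] exceeds [k], so that the [k]-th term occurs, and is at least [K], so that [Sq K <= Sq L]. *)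
apply: S_leP => K; pose L := (K + k.+1)%N.
have SqKL : Sq K (x + y) <= Sq L (x + y).
  rewrite /Sq /L big_split_ord /= lerDl sumr_ge0// => i _.
  by rewrite mulr_ge0// ltW.
have gSq : gap (Sq L) x y = \sum_(i < L) w i * gap (v i) x y.
  rewrite /gap /Sq !mulr_sumr -big_split/= -sumrB; apply: eq_bigr => i _.
  by ring.
have kL : (k < L)%N by rewrite /L addnS ltnS leq_addl.
have : w k * gap (fun z => p k z ^+ 2) x y <= gap (Sq L) x y.
  rewrite gSq (bigD1 (Ordinal kL))//= -[leLHS]addr0; apply: lerD.
    by rewrite ler_wpM2l ?(ltW (w_gt0 k))// gv lerDl.
  by apply: sumr_ge0 => i _; rewrite mulr_ge0 ?(ltW (w_gt0 i))// gv addr_ge0.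
have := Sq_leS L x; have := Sq_leS L y; rewrite [gap (Sq L) x y]/gap; lra.
Qed.

Let gap_cvg x (u : nat -> X) : gap S x (u n) @[n --> \oo] --> (0 : R) ->
  forall k, p k (u n) @[n --> \oo] --> p k x /\
    p k (x + u n) @[n --> \oo] --> 2 * p k x.
Proof.
move=> g0 k.
have gp0 : gap (fun z => p k z ^+ 2) x (u n) @[n --> \oo] --> (0 : R).
  apply: (@squeeze_cvgr _ _ _ _ (fun=> 0) (fun n => (w k)^-1 * gap S x (u n))).
  - by apply: nearW => n; rewrite gap_sqr_ge0/= ler_pdivlMl// gap_le.
  - exact: cvg_cst.
  - by rewrite -[X in _ --> X](mulr0 (w k)^-1); apply: cvgM => //; exact: cvg_cst.
have pu : p k (u n) @[n --> \oo] --> p k x.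
  apply/cvgrPdist_lt => e e0.
  have e20 : 0 < e ^+ 2 by rewrite exprn_gt0.
  move/cvgrPdist_lt : gp0 => /(_ _ e20); apply: filterS => n.
  rewrite sub0r normrN ger0_norm// => ge.
  have := le_lt_trans (gap_sqr k x (u n)) ge.
  by rewrite -real_normK ?num_real// ltr_pXn2r// nnegrE// ltW.
split=> //.
(* Solving the definition of the gap for [p k (x + u n)] reduces its limit to that of
   [p k (u n)]. *)
have pE n : p k (x + u n) =
    Num.sqrt (2 * p k x ^+ 2 + 2 * p k (u n) ^+ 2 - gap (fun z => p k z ^+ 2) x (u n)).
  by rewrite /gap subKr sqrtr_sqr ger0_norm.
under eq_fun do rewrite pE.
have -> : 2 * p k x = Num.sqrt (2 * p k x ^+ 2 + 2 * p k x ^+ 2 - 0).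
  rewrite -[LHS]ger0_norm ?mulr_ge0// -sqrtr_sqr; congr Num.sqrt; ring.
apply: continuous_cvg; first exact: sqrt_continuous.
apply: cvgB => //; apply: cvgD; first exact: cvg_cst.
apply: cvgM; first exact: cvg_cst.
by rewrite expr2; under eq_fun do rewrite expr2; exact: cvgM.
Qed.

Lemma square_sum_renorming : exists M : X -> R,
  [/\ equivalent_norm M, sigma_lsc F M &
      forall x (u : nat -> X),
        (2 * M x ^+ 2 + 2 * M (u n) ^+ 2 - M (x + u n) ^+ 2) @[n --> \oo]
          --> (0 : R) ->
        forall k, p k (u n) @[n --> \oo] --> p k x /\
          p k (x + u n) @[n --> \oo] --> 2 * p k x].
Proof.
pose M x := Num.sqrt (S x).
have M2 x : M x ^+ 2 = S x by rewrite sqr_sqrtr.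
have N0 x : 0 <= N x by exact: is_norm_ge0.
have NM x : N x <= M x.
  by rewrite -[N x]ger0_norm// -sqrtr_sqr ler_wsqrtr.
have MN x : M x <= 2 * C * N x.
  have h : 0 <= 2 * C * N x by rewrite !mulr_ge0// ltW.
  rewrite -[leRHS]ger0_norm// -sqrtr_sqr ler_wsqrtr//.
  by apply: le_trans (S_leB x) _; have := B_ge0 x; rewrite !exprMn; lra.
have S_eq0 x : S x = 0 -> x = 0.
  move=> Sx; have := S_geN x; rewrite Sx => h.
  by apply/(is_norm_eq0 x nN)/eqP; rewrite -sqrf_eq0 eq_le h sqr_ge0.
exists M; split.
- split.
    split.
    + exact: sqrt_subadditive.
    + by move=> a x; rewrite /M SZ sqrtrM ?sqr_ge0// sqrtr_sqr.
    + by move=> x Mx; apply: S_eq0; rewrite -M2 Mx expr0n.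
  have [_ [c [D [c0 D0 cND]]]] := eN.
  exists c, (2 * C * D); split=> //; first by rewrite !mulr_gt0.
  move=> x; have /andP[cN ND] := cND x.
  rewrite (le_trans cN (NM x))/= (le_trans (MN x))// -[leRHS]mulrA ler_wpM2l//.
  by rewrite mulr_ge0// ltW.
- apply/sigma_lscP; apply: (@lsc_sqrt R (sigma_space F)); first exact: S_ge0.
  apply: (@lsc_sup R (sigma_space F)); [by exists 0%N|exact: Sq_ub|move=> K _].
  apply: (@lsc_sum R (sigma_space F) (fun k x => w k * v k x)) => k.
  apply: (@lscZ R (sigma_space F)); first exact: ltW.
  apply: (@lscD R (sigma_space F)); first exact: lsc_sqr.
  exact: (lsc_opp dF (@lsc_sqr R (sigma_space F) _ (p0 k) (@lp k))).
- move=> x u; under eq_fun do rewrite !M2; exact: gap_cvg.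
Qed.

End SquareSum.

(** * From slices to a LUR norm *)

Section SliceNorms.
Context {R : realType} {X : normedModType R} (F : set (X -> R^o)).
Variable N : X -> R.
Hypotheses (nF : norming_subspace F) (eN : equivalent_norm N).
Hypothesis lN : sigma_lsc F N.

Let nN : is_norm N. Proof. by case: eN. Qed.

Let N0 x : 0 <= N x. Proof. exact: is_norm_ge0. Qed.

Let NZ (a : R) x : 0 <= a -> N (a *: x) = a * N x.
Proof. exact: (is_norm_sublinear nN).2. Qed.

Let ND x y : N (x + y) <= N x + N y.
Proof. exact: (is_norm_sublinear nN).1. Qed.

Let unit_sphereP (x : sigma_sphere F N) : N (set_val x) = 1.
Proof. exact: (set_valP x). Qed.

Lemma dual_space_bounded f : dual_space f ->
  exists2 K : R, 0 < K & forall x, `|f x| <= K * N x.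
Proof.
move=> [lf cf]; have [_ [c [d1 [c0 _ cN]]]] := eN.
have /cvgrPdist_lt /(_ 1 ltr01) /nbhs_ballP [d /= d0 fd] := cf 0.
exists (2 / (d * c)); first by rewrite divr_gt0// mulr_gt0.
move=> x; have [->|x0] := eqVneq x 0.
  by rewrite linear_fun0// normr0 mulr_ge0// divr_ge0// mulr_ge0// ltW.
have nx0 : 0 < `|x| by rewrite normr_gt0.
(* This rescales [x] to norm [d / 2], inside the ball where [|f| < 1]; [c] then converts the
   original norm into [N]. *)
pose k := d / 2 / `|x|; have k0 : 0 < k by rewrite !divr_gt0.
have : `|f (k *: x)| < 1.
  have := fd (k *: x); rewrite (linear_fun0 lf) sub0r normrN; apply.
  rewrite -ball_normE /= sub0r normrN normrZ gtr0_norm// /k divfK ?gt_eqF//.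
  by lra.
rewrite (linear_funZ lf) normrM gtr0_norm// -ltr_pdivlMl// mulr1 => /ltW h.
apply: le_trans h _; have /andP[cNx _] := cN x.
rewrite /k !invf_div -[leLHS]mulrC.
apply: (@le_trans _ _ (2 / (d * c) * (c * `|x|))); last first.
  by rewrite ler_wpM2l// divr_ge0// mulr_ge0// ltW.
rewrite le_eqVlt; apply/orP; left; apply/eqP; field.
by rewrite !gt_eqF.
Qed.

Variable G : nat -> set (set (sigma_sphere F N)).

(* Slices normalised by [f <= N]; the bound on [a] keeps [slice_norm] finite. *)
Definition star_slices n : set ((X -> R^o) * R) := [set fa |
  [/\ F fa.1, forall y, fa.1 y <= N y, -2 <= fa.2 <= 1 &
    forall x y : sigma_sphere F N, fa.2 < fa.1 (set_val x) ->
      fa.2 < fa.1 (set_val y) -> star x (G n) y]].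

(* On the sphere of [N] this is [1 + max (f - a) 0], so it exceeds [N] exactly
   on the slice [f > a]; convexity is why [(f - a N)^+] is shifted by [N]. *)
Definition slice_gauge (fa : (X -> R^o) * R) x : R :=
  Num.max (fa.1 x + (1 - fa.2) * N x) (N x).

Definition slice_norm n x : R := sup [set slice_gauge fa x | fa in star_slices n].

Lemma star_slices_ne n : star_slices n !=set0.
Proof.
have [F0 _ _] := norming_functional_subspace nF.
have zeroE x : (0 : X -> R^o) x = 0 by [].
(* The slice where [0 > 1] is empty, so its star condition is vacuous. *)
exists (0, 1); split=> //=.
- by apply/andP; split; lra.
- by move=> x y; rewrite zeroE; lra.
Qed.

Lemma slice_gauge_le n fa x : star_slices n fa -> slice_gauge fa x <= 4 * N x.
Proof.
move=> [_ fN /andP[a2 a1] _]; rewrite ge_max.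
have := fN x; have := ler_wpM2r (N0 x) a2; have := N0 x.
by move=> h1 h2 h3; apply/andP; split; lra.
Qed.

(** The bound [a <= 1] makes the coefficient of [N] nonnegative, so a maximum of sublinear
    functionals remains. *)
Lemma slice_gauge_sublinear n fa : star_slices n fa -> sublinear (slice_gauge fa).
Proof.
move=> [Ff fN /andP[a2 a1] _]; have lf := norming_linear nF Ff.
have a1' : 0 <= 1 - fa.2 by lra.
split=> [x y|a x a0]; rewrite /slice_gauge.
  rewrite ge_max; apply/andP; split.
    apply: (@le_trans _ _ ((fa.1 x + (1 - fa.2) * N x) + (fa.1 y + (1 - fa.2) * N y))).
      by rewrite (linear_funD lf); have := ler_wpM2l a1' (ND x y); lra.
    by apply: lerD; rewrite le_max lexx.
  by apply: le_trans (ND x y) _; apply: lerD; rewrite le_max lexx orbT.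
by rewrite (linear_funZ lf) NZ// maxr_pMr//; congr Num.max; ring.
Qed.

Let gauge_ub n x : has_ubound [set slice_gauge fa x | fa in star_slices n].
Proof. by exists (4 * N x) => _ [fa Ifa <-]; exact: slice_gauge_le Ifa. Qed.

Lemma slice_gauge_le_norm n fa x : star_slices n fa ->
  slice_gauge fa x <= slice_norm n x.
Proof. by move=> Ifa; apply: ub_le_sup => //; exists fa. Qed.

Let slice_norm_leP n x b :
  (forall fa, star_slices n fa -> slice_gauge fa x <= b) -> slice_norm n x <= b.
Proof.
move=> H; apply: ge_sup; last by move=> _ [fa Ifa <-]; exact: H.
by have [fa Ifa] := star_slices_ne n; exists (slice_gauge fa x), fa.
Qed.

Lemma slice_norm_le n x : slice_norm n x <= 4 * N x.
Proof. by apply: slice_norm_leP => fa; exact: slice_gauge_le. Qed.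

Lemma slice_norm_ge0 n x : 0 <= slice_norm n x.
Proof.
have [fa Ifa] := star_slices_ne n.
apply: le_trans (slice_gauge_le_norm x Ifa).
by rewrite le_max N0 orbT.
Qed.

Lemma slice_norm_sublinear n : sublinear (slice_norm n).
Proof.
apply: sublinearI => [x y||a x a0].
- apply: slice_norm_leP => fa Ifa.
  apply: le_trans ((slice_gauge_sublinear Ifa).1 x y) _.
  by apply: lerD; exact: slice_gauge_le_norm.
- apply/le_anti; rewrite slice_norm_ge0 andbT.
  apply: le_trans (slice_norm_le n 0) _.
  by rewrite (sublinear0 (is_norm_sublinear nN)) mulr0.
- apply: slice_norm_leP => fa Ifa.
  rewrite (slice_gauge_sublinear Ifa).2 ?(ltW a0)//.
  by rewrite ler_wpM2l ?(ltW a0)//; exact: slice_gauge_le_norm.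
Qed.

Lemma slice_norm_lsc n : @lsc R (sigma_space F) (slice_norm n).
Proof.
have lN' := (sigma_lscP F N).1 lN.
apply: (@lsc_sup R (sigma_space F)); [exact: star_slices_ne|exact: gauge_ub|].
move=> fa [Ff _ /andP[_ a1] _].
apply: (@lsc_max R (sigma_space F)); last exact: lN'.
apply: (@lscD R (sigma_space F)); last first.
  by apply: (@lscZ R (sigma_space F)) lN'; lra.
move=> x a ax.
exact: (@sigma_continuous_functional _ _ F fa.1 x Ff) [set t : R | a < t] (lt_nbhsr ax).
Qed.

Hypothesis dG : development G.
Hypothesis sG : forall n D, G n D -> sphere_slice D.

Lemma star_slices_cover n (u : sigma_sphere F N) :
  exists2 fa, star_slices n fa & fa.2 < fa.1 (set_val u).
Proof.
have [_ FD FZ] := norming_functional_subspace nF.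
have [D GD Du] : exists2 D, G n D & D u.
  have [_ cov] := dG.1 n.
  by have : [set: sigma_sphere F N] u by []; rewrite -cov => -[D]; exists D.
have [f [a [Ff _ DE]]] := sG GD; have lf := norming_linear nF Ff.
have [K K0 fK] := dual_space_bounded (norming_dual nF Ff).
have f1 x : K^-1 * f x <= N x.
  by rewrite ler_pdivrMl//; apply: le_trans (fK x); exact: ler_norm.
have Ki : 0 < K^-1 by rewrite invr_gt0.
have fge (x : sigma_sphere F N) : -1 <= K^-1 * f (set_val x).
  have := f1 (- set_val x); rewrite (linear_funN lf) (is_normN _ nN) unit_sphereP.
  by rewrite mulrN; lra.
(* On the sphere [K^-1 * f >= -1], so raising the threshold to [-2] leaves the slice unchanged. *)
pose b := Num.max (K^-1 * a) (-2).
have bE (x : sigma_sphere F N) : (b < K^-1 * f (set_val x)) = (a < f (set_val x)).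
  rewrite gt_max ltr_pM2l// andb_idr// => _.
  by have := fge x; lra.
have au : a < f (set_val u) by move: Du; rewrite DE.
exists (K^-1 *: f, b) => /=; last by rewrite bE.
split=> /=.
- exact: FZ.
- exact: f1.
- rewrite le_max lexx orbT/= ge_max; apply/andP; split; last by lra.
  have := f1 (set_val u); rewrite unit_sphereP; apply: le_trans.
  by apply: ler_wpM2l; exact: ltW.
- move=> x y; rewrite !bE => ax ay; exists D; last by rewrite DE.
  by split=> //; rewrite DE.
Qed.

Lemma star_eventually n (a : sigma_sphere F N) x (u : nat -> X) :
  0 < N x -> set_val a = (N x)^-1 *: x ->
  N (u k) @[k --> \oo] --> N x ->
  slice_norm n (u k) @[k --> \oo] --> slice_norm n x ->
  slice_norm n (x + u k) @[k --> \oo] --> 2 * slice_norm n x ->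
  \forall k \near \oo, 0 < N (u k) /\
    forall b : sigma_sphere F N, set_val b = (N (u k))^-1 *: u k ->
      star a (G n) b.
Proof.
move=> Nx ax Nu qu qxu.
have in_slice fa z (b : sigma_sphere F N) : star_slices n fa -> 0 < N z ->
    set_val b = (N z)^-1 *: z ->
    (N z < slice_gauge fa z) = (fa.2 < fa.1 (set_val b)).
  move=> [Ff _ _ _] Nz ->; rewrite (linear_funZ (norming_linear nF Ff)).
  rewrite /slice_gauge lt_max ltxx orbF ltr_pdivlMl//.
  by apply/idP/idP; lra.
(* The excess [e] is positive because some admissible slice contains [a]. *)
pose q := slice_norm n x; pose e := q - N x.
have e0 : 0 < e.
  have [fa Ifa fa_a] := star_slices_cover n a.
  rewrite subr_gt0; apply: lt_le_trans (slice_gauge_le_norm x Ifa).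
  by rewrite (in_slice fa x a).
have e4 : 0 < e / 4 by rewrite divr_gt0.
near=> k.
have h1 : `|N x - N (u k)| < e / 4.
  by near: k; exact: (cvgrPdist_lt _ _).1 Nu _ e4.
have h2 : `|q - slice_norm n (u k)| < e / 4.
  by near: k; exact: (cvgrPdist_lt _ _).1 qu _ e4.
have h3 : `|2 * q - slice_norm n (x + u k)| < e / 4.
  by near: k; exact: (cvgrPdist_lt _ _).1 qxu _ e4.
have Nuk : 0 < N (u k) by near: k; exact: (cvgr_gt _ Nu).
split=> // b bE.
move: h1 h2 h3; rewrite !ltr_distl => /andP[h1 h1'] /andP[h2 h2'] /andP[h3 h3'].
have : 2 * q - e / 4 < slice_norm n (x + u k) by lra.
move=> /sup_gt[|_ [fa Ifa <-] hfa].
  by have [fa Ifa] := star_slices_ne n; exists (slice_gauge fa (x + u k)), fa.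
(* Subadditivity makes the gauge exceed [q - e / 2] at [x] and [q - e / 4] at [u k], whereas
   [N x = q - e] and [N (u k) < q - 3 * e / 4]. Both normalised points thus lie in the slice of
   [fa]. *)
have gD := (slice_gauge_sublinear Ifa).1 x (u k).
have gx : slice_gauge fa x <= q := slice_gauge_le_norm x Ifa.
have gu := slice_gauge_le_norm (u k) Ifa.
have [_ _ _] := Ifa; apply.
  by rewrite -(in_slice fa x a)// /e in h1 h1' h2 h2' h3 h3' hfa *; lra.
by rewrite -(in_slice fa (u k) b)// /e in h1 h1' h2 h2' h3 h3' hfa *; lra.
Unshelve. all: by end_near. Qed.

Lemma slice_development_LUR : exists M : X -> R,
  [/\ equivalent_norm M, sigma_lsc F M & sigma_LUR F M].
Proof.
(* Placing [N] at index 0 also yields [N (u k) --> N x], needed to undo the normalisation. *)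
pose p k : X -> R := if k is n.+1 then slice_norm n else N.
have ps k : sublinear (p k).
  by case: k => [|n]; [exact: is_norm_sublinear|exact: slice_norm_sublinear].
have p0 k x : 0 <= p k x by case: k => [|n]; [exact: N0|exact: slice_norm_ge0].
have pC k x : p k x <= 4 * N x.
  by case: k => [|n] /=; [have := N0 x; lra|exact: slice_norm_le].
have lp k : @lsc R (sigma_space F) (p k).
  by case: k => [|n]; [exact/sigma_lscP|exact: slice_norm_lsc].
have [M [eM lM MP]] := square_sum_renorming (norming_dual nF) eN
  (ltr0Sn R 3) (erefl : p 0%N = N) ps p0 pC (@lp).
exists M; split=> // x u /MP {}MP.
have Nu : N (u k) @[k --> \oo] --> N x := (MP 0%N).1.
have FF : Filter ((u : nat -> X) @ \oo) by exact: fmap_filter.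
apply: (sigma_cvgP F x FF).2 => f Ff.
have lf := norming_linear nF Ff.
have [K K0 fK] := dual_space_bounded (norming_dual nF Ff).
(* The origin has no direction on the sphere; there [N (u k) --> 0] and [|f| <= K * N] suffice. *)
have [x0|x0] := eqVneq x 0.
  rewrite x0 linear_fun0//; apply/cvgrPdist_lt => e e0.
  have eK : 0 < K^-1 * e by rewrite mulr_gt0// invr_gt0.
  move/cvgrPdist_lt : Nu => /(_ _ eK); apply: filterS => k /=.
  rewrite x0 (sublinear0 (is_norm_sublinear nN)) !sub0r !normrN.
  rewrite (ger0_norm (N0 _)) ltr_pdivlMl// => h.
  exact: le_lt_trans (fK _) h.
have Nx : 0 < N x.
  rewrite lt_def N0 andbT; apply/eqP => /(is_norm_eq0 x nN) /eqP.
  exact/negP.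
have sphere z : 0 < N z ->
    {a : sigma_sphere F N | set_val a = (N z)^-1 *: z}.
  move=> Nz; have S1 : unit_sphere N ((N z)^-1 *: z).
    by rewrite /unit_sphere /= NZ ?invr_ge0 ?ltW// mulVf// gt_eqF.
  by exists (SigSub (mem_set S1)).
have [a ax] := sphere x Nx.
pose v k := (N (u k))^-1 *: u k.
(* The development turns membership in the stars of [a] into sigma(X,F)-convergence of directions;
   multiplying by [N (u k)] then recovers [u]. *)
have va : v k @[k --> \oo] --> (set_val a : sigma_space F).
  move=> W Wa.
  have : nbhs a [set b : sigma_sphere F N | W (set_val b)].
    by apply/sphere_nbhsP; exists W.
  move=> /(dG.2 a).2 [n starW].
  have := star_eventually Nx ax Nu (MP n.+1).1 (MP n.+1).2.
  apply: filterS => k [Nuk /=]; have [b bE] := sphere _ Nuk.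
  by move=> /(_ b bE) /starW /=; rewrite bE.
have FV : Filter ((v : nat -> X) @ \oo) by exact: fmap_filter.
have fva := (sigma_cvgP F (set_val a) FV).1 va f Ff.
have fu k : f (u k) = N (u k) * f (v k).
  have [Nuk|Nuk] := eqVneq (N (u k)) 0.
    by rewrite Nuk mul0r ((is_norm_eq0 _ nN).1 Nuk) linear_fun0.
  by rewrite /v (linear_funZ lf) mulVKf.
have -> : f x = N x * f (set_val a).
  by rewrite ax (linear_funZ lf) mulVKf// gt_eqF.
have : (fun k => f (u k) : R) @ \oo --> (N x * f (set_val a) : R).
  by under eq_fun do rewrite fu; exact: cvgM.
exact.
Qed.

End SliceNorms.

Theorem theorem1p1 (R : realType) (X : completeNormedModType R)
    (F : set (X -> R^o)) (hF : norming_subspace F) :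
  [<-> (* (i) *)
       exists N : X -> R,
         [/\ equivalent_norm N, sigma_lsc F N & sigma_LUR F N];
       (* (ii) *)
       exists N : X -> R,
         [/\ equivalent_norm N, sigma_lsc F N
           & exists rho : sigma_sphere F N -> sigma_sphere F N -> R,
               [/\ symmetric_fun rho, symmetrized_by rho
                 & forall (x : sigma_sphere F N) (e : R), 0 < e ->
                     exists D : set (sigma_sphere F N),
                       [/\ sphere_slice D, D x
                         & (rho_diameter rho D < e%:E)%E]]];
       (* (iii) *)
       exists N : X -> R,
         [/\ equivalent_norm N, sigma_lsc F N
           & exists G : nat -> set (set (sigma_sphere F N)),
               development G /\ forall n D, G n D -> sphere_slice D]].
Proof.
tfae.
- move=> [N [eN lN rN]]; have [nN _] := eN; exists N; split=> //.
  exists (fun x y => 2 - N (set_val x + set_val y)); split.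
  + exact: LUR_symmetric.
  + exact: LUR_symmetrized.
  + exact: LUR_small_slices.
- move=> [N [eN lN [rho [_ rs small]]]]; exists N; split=> //.
  exact: small_slices_development.
- move=> [N [eN lN [G [dG sG]]]].
  exact: slice_development_LUR dG sG.
Qed.
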